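(* Let $k\ge1$ be an integer, let $\mathbf{e}\in\mathbb{R}^k$ be a unit vector, and let $\lambda\in(0,\infty)$. Let $\mathbf{X}$ be a random vector in $\mathbb{R}^k$ with a density $p$ with respect to Lebesgue measure such that $\mathsf{E}\,e^{\lambda\,\mathbf{e}\mathbf{X}}<\infty$ and, for some $\mu\in[0,\lambda)$ and some $C\in(0,\infty)$, $$p(\mathbf{x})\le C\,e^{-\mu\,\mathbf{e}\mathbf{x}}\quad\text{for all }\mathbf{x}\in\mathbb{R}^k.$$ Then for each $t\in(0,\lambda)$ there exists a natural number $n_t$ such that for all natural $n\ge n_t$ the $n$-fold convolution $\tilde p_t^{*n}$ of the $t$-tilted density $$\tilde p_t(\mathbf{x}):=\frac{e^{t\,\mathbf{e}\mathbf{x}}\,p(\mathbf{x})}{\mathsf{E}\,e^{t\,\mathbf{e}\mathbf{X}}}\qquad(\mathbf{x}\in\mathbb{R}^k)$$ is bounded.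
   Context: For $\mathbf{e},\mathbf{x}\in\mathbb{R}^k$, the juxtaposition $\mathbf{e}\mathbf{x}$ denotes the Euclidean scalar product. For a density $q$ on $\mathbb{R}^k$, $q^{*n}$ denotes the $n$-fold convolution of $q$ with itself ($q^{*1}=q$), where convolution is defined pointwise by $(p*q)(\mathbf{x})=\int_{\mathbb{R}^k}p(\mathbf{x}-\mathbf{u})q(\mathbf{u})\,d\mathbf{u}$. *)

(* Defs.v *)
From HB Require Import structures.
From mathcomp Require Import all_boot all_order all_algebra.
From mathcomp Require Import all_classical all_reals all_analysis.

Set Implicit Arguments.
Unset Strict Implicit.
Unset Printing Implicit Defensive.

Import Order.TTheory GRing.Theory Num.Theory.
Import numFieldNormedType.Exports.

Local Open Scope classical_set_scope.
Local Open Scope ring_scope.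

Section scalar_product.
Context {R : realType} {k : nat}.
Implicit Types x y : 'rV[R]_k.

Definition dotv x y : R := \sum_(i < k) x 0 i * y 0 i.

(* The library's norm on 'rV[R]_k is the sup norm. *)
Definition normv2 x : R := Num.sqrt (dotv x x).

End scalar_product.

Definition measure_row_display : measure_display -> measure_display.
Proof. exact. Qed.

(* The product sigma-algebra on row vectors, as the library does for tuples;
   for 'rV[R]_n it is the Borel sigma-algebra of R^n. *)
Section measurable_row.
Context {d} {T : sigmaRingType d}.
Variable n : nat.

Let coors : 'I_n -> 'rV[T]_n -> T := fun i x => x ord0 i.

Let row_set0 : g_sigma_preimage coors set0.
Proof. exact: sigma_algebra0. Qed.

Let row_setC A : g_sigma_preimage coors A -> g_sigma_preimage coors (~` A).
Proof. exact: sigma_algebraC. Qed.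

Let row_bigcup (F : _^nat) : (forall i, g_sigma_preimage coors (F i)) ->
  g_sigma_preimage coors (\bigcup_i (F i)).
Proof. exact: sigma_algebra_bigcup. Qed.

HB.instance Definition _ := @isMeasurable.Build (measure_row_display d)
  'rV[T]_n (g_sigma_preimage coors) row_set0 row_setC row_bigcup.

End measurable_row.

Section measurable_row_theory.
Context {R : realType}.

Lemma measurable_coor n (i : 'I_n) :
  measurable_fun [set: 'rV[R]_n] (fun x => x ord0 i).
Proof.
move=> _ Y mY; rewrite setTI; apply: sub_sigma_algebra => /=.
rewrite -bigcup_seq/=; exists i => /=; first by rewrite mem_index_enum.
by exists Y => //; rewrite setTI.
Qed.

Lemma measurable_fun_rowP d (T : measurableType d) n (f : T -> 'rV[R]_n) :
  measurable_fun [set: T] f <->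
  forall i, measurable_fun [set: T] (fun t => f t ord0 i).
Proof.
split=> [mf i|mf]; first exact: (measurableT_comp (measurable_coor i)).
suff H : <<s \big[setU/set0]_(i < n) preimage_set_system setT
    (fun x : 'rV[R]_n => x ord0 i) measurable >> `<=`
    [set A | measurable (f @^-1` A)].
  by move=> _ A mA; rewrite setTI; exact: H.
apply: smallest_sub.
  split => /=; first by rewrite preimage_set0.
    by move=> A mA; rewrite setTD preimage_setC; exact: measurableC.
  by move=> F mF; rewrite preimage_bigcup; exact: bigcupT_measurable.
rewrite -bigcup_seq => A [i _ [B mB <-]] /=.
by rewrite setTI -[X in measurable X]setTI; exact: mf.
Qed.

Definition row_cons n (z : R * 'rV[R]_n) : 'rV[R]_n.+1 :=
  row_mx (const_mx z.1 : 'rV[R]_1) z.2.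

Definition row_uncons n (x : 'rV[R]_n.+1) : R * 'rV[R]_n :=
  (x ord0 ord0, \row_i x ord0 (lift ord0 i)).

Lemma row_cons0 n (z : R * 'rV[R]_n) : row_cons z ord0 ord0 = z.1.
Proof. by rewrite mxE; case: splitP => [j _|j //]; rewrite mxE. Qed.

Lemma row_consS n (z : R * 'rV[R]_n) i :
  row_cons z ord0 (lift ord0 i) = z.2 ord0 i.
Proof.
rewrite mxE; case: splitP => [j|j [ij]]; first by rewrite (ord1 j).
by congr (z.2 _ _); apply: val_inj.
Qed.

Lemma row_consK n : cancel (@row_cons n) (@row_uncons n).
Proof.
move=> [r v]; rewrite /row_uncons row_cons0; congr pair.
by apply/rowP => i; rewrite mxE row_consS.
Qed.

Lemma row_unconsK n : cancel (@row_uncons n) (@row_cons n).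
Proof.
move=> x; apply/rowP => i; case: (unliftP ord0 i) => [j ->|->].
  by rewrite row_consS mxE.
by rewrite row_cons0.
Qed.

Lemma measurable_row_cons n : measurable_fun setT (@row_cons n).
Proof.
apply/measurable_fun_rowP => i; case: (unliftP ord0 i) => [j ->|->].
  under eq_fun do rewrite row_consS.
  exact: (measurableT_comp (measurable_coor j) measurable_snd).
under eq_fun do rewrite row_cons0.
exact: measurable_fst.
Qed.

Lemma measurable_row_uncons n : measurable_fun setT (@row_uncons n).
Proof.
apply/measurable_fun_pair; first exact: measurable_coor.
apply/measurable_fun_rowP => i; under eq_fun do rewrite mxE.
exact: measurable_coor.
Qed.

End measurable_row_theory.

Section lebesgue_row_step.
Context {R : realType} {n : nat}.
Local Open Scope ereal_scope.
Variable mu : {sigma_finite_measure set 'rV[R]_n -> \bar R}.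

Definition lebesgue_row_step : set 'rV[R]_n.+1 -> \bar R :=
  pushforward (lebesgue_measure \x mu) (@row_cons R n).

Let mcons : measurable_fun [set: measurableTypeR R * 'rV[R]_n]
  (@row_cons R n) := @measurable_row_cons R n.

Let step0 : lebesgue_row_step set0 = 0.
Proof. by rewrite /lebesgue_row_step /pushforward preimage_set0 measure0. Qed.

Let step_ge0 A : 0 <= lebesgue_row_step A.
Proof. exact: measure_ge0. Qed.

Let step_sigma_additive : semi_sigma_additive lebesgue_row_step.
Proof.
pose m : {measure set (measurableTypeR R * 'rV[R]_n)%type -> \bar R} :=
  lebesgue_measure \x mu.
move=> F mF tF mUF; rewrite /lebesgue_row_step /pushforward preimage_bigcup.
apply: (@measure_semi_sigma_additive _ _ _ m).
- by move=> i; rewrite -[X in measurable X]setTI; exact: mcons.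
- apply/trivIsetP => /= i j _ _ ij; rewrite -preimage_setI.
  by move/trivIsetP : tF => /(_ _ _ _ _ ij) ->//; rewrite preimage_set0.
- by rewrite -preimage_bigcup -[X in measurable X]setTI; exact: mcons.
Qed.

HB.instance Definition _ := isMeasure.Build _ _ _ lebesgue_row_step
  step0 step_ge0 step_sigma_additive.

Let step_sigma_finite : sigma_finite setT lebesgue_row_step.
Proof.
have /sigma_finiteP[F [TF ndF Foo]] := sigma_finiteT (@lebesgue_measure R).
have /sigma_finiteP[G [TG ndG Goo]] := sigma_finiteT mu.
exists (fun i => @row_uncons R n @^-1` (F i `*` G i)).
  rewrite -preimage_bigcup -(preimage_setT (@row_uncons R n)); congr preimage.
  rewrite -setXTT TF TG predeqE => -[x y]; split.
    move=> [/= [i _ Fix] [j _ Gjy]]; exists (maxn i j) => //; split.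
    - by move: x Fix; exact/subsetPset/ndF/leq_maxl.
    - by move: y Gjy; exact/subsetPset/ndG/leq_maxr.
  by move=> [i _ []/= ? ?]; split; exists i.
move=> i; have [mF Fi] := Foo i; have [mG Gi] := Goo i.
split.
  rewrite -[X in measurable X]setTI; apply: measurable_row_uncons => //.
  exact: measurableX.
rewrite /lebesgue_row_step /pushforward.
rewrite (_ : _ @^-1` _ = F i `*` G i); last first.
  by apply/seteqP; split=> z; rewrite /preimage /mkset row_consK.
by rewrite product_measure1E// lte_mul_pinfty// ge0_fin_numE.
Qed.

HB.instance Definition _ := Measure_isSigmaFinite.Build _ _ _
  lebesgue_row_step step_sigma_finite.

End lebesgue_row_step.

(* Lebesgue measure on R^n (on its Borel sets), by iterated products. *)
Fixpoint lebesgue_row {R : realType} n :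
    {sigma_finite_measure set 'rV[R]_n -> \bar R} :=
  if n is n'.+1 then lebesgue_row_step (lebesgue_row n')
  else dirac (0 : 'rV[R]_0).

Lemma lebesgue_row_box (R : realType) n (A : 'I_n -> set R) :
  (forall i, measurable (A i)) ->
  lebesgue_row n [set x : 'rV[R]_n | forall i, A i (x ord0 i)] =
  (\prod_(i < n) lebesgue_measure (A i : set (measurableTypeR R)))%E.
Proof.
elim: n A => [|n IHn] A mA.
  by rewrite big_ord0 /= diracE mem_set//= => -[].
rewrite big_ord_recl -IHn//=.
have mB : measurable
    [set x : 'rV[R]_n | forall i, A (lift ord0 i) (x ord0 i)].
  rewrite (_ : mkset _ = \bigcap_(i in [set: 'I_n])
      ((fun x : 'rV[R]_n => x ord0 i) @^-1` A (lift ord0 i))).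
    apply: fin_bigcap_measurable => // i _.
    by rewrite -[X in measurable X]setTI; exact: measurable_coor.
  apply/seteqP; split=> [x xA i _|x xA i]; first exact: xA.
  exact: (xA i).
have mA0 : measurable (A ord0 : set (measurableTypeR R)) by exact: mA.
rewrite -(product_measure1E _ _ mA0 mB).
rewrite /lebesgue_row_step /pushforward; congr (product_measure1 _ _ _).
apply/seteqP; split=> [z zA|z [z1 z2] i].
  split=> [|i]; first by have := zA ord0; rewrite row_cons0.
  by have := zA (lift ord0 i); rewrite row_consS.
by case: (unliftP ord0 i) => [j ->|->]; rewrite ?row_consS ?row_cons0//;
  exact: z2.
Qed.

Section density.
Context {R : realType} {k : nat}.
Local Open Scope ereal_scope.

Definition is_density d (T : measurableType d) (P : probability T R)
    (X : {RV P >-> 'rV[R]_k}) (p : 'rV[R]_k -> R) : Prop :=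
  [/\ measurable_fun [set: 'rV[R]_k] p,
      forall x, (0 <= p x)%R &
      forall A, measurable A ->
        distribution P X A = \int[lebesgue_row k]_(x in A) (p x)%:E].

Definition tilted_density d (T : measurableType d) (P : probability T R)
    (X : {RV P >-> 'rV[R]_k}) (e : 'rV[R]_k) (t : R) (p : 'rV[R]_k -> R) :
    'rV[R]_k -> R :=
  fun x => (expR (t * dotv e x) * p x
            / fine 'E_P[fun w => expR (t * dotv e (X w))])%R.

(* Extended-real valued: a pointwise convolution of nonnegative functions may
   be infinite at some points. *)
Definition convolution (f g : 'rV[R]_k -> \bar R) : 'rV[R]_k -> \bar R :=
  fun x => \int[lebesgue_row k]_u (f (x - u)%R * g u).

(* The n-fold convolution of f with itself for n >= 1; junk value for n = 0. *)
Definition convolution_iter (f : 'rV[R]_k -> \bar R) (n : nat) :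
    'rV[R]_k -> \bar R :=
  iterop n convolution f (cst 0).

Definition ebounded (f : 'rV[R]_k -> \bar R) : Prop :=
  exists M : R, forall x, `|f x| <= M%:E.

End density.

(* Main.v *)
From HB Require Import structures.
Require Import Defs.
From mathcomp Require Import all_boot all_order all_algebra.
From mathcomp Require Import all_classical all_reals all_analysis.
From mathcomp Require Import measurable_realfun lra ring.

Set Implicit Arguments.
Unset Strict Implicit.
Unset Printing Implicit Defensive.

Import Order.TTheory GRing.Theory Num.Theory.
Import numFieldNormedType.Exports.

Local Open Scope classical_set_scope.
Local Open Scope ring_scope.

(** Write f for the tilted density and e.x for the scalar product. The bound on
    p gives f x <= C expR (l * y x) with y x = (t - mu) / l * e.x, for every
    l >= 1 and a constant C independent of l. The (l+1)-fold convolution of f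
    at x integrates a product f u_0 * ... * f u_l over u_0 + ... + u_l = x.
    Apply the bound only to the factor at the index i for which y u_i is least:
    then expR (l * y u_i) is at most the product over j != i of expR (y u_j),
    whence [prod_le_sum_omit_one]: the product is at most C times the sum over
    i of the products over j != i of f u_j * expR (y u_j).

    In the i-th term the point u_i no longer occurs, so the other l points are
    unconstrained and the term integrates to J ^ l, where J is the integral of
    f * expR y; the bound does not depend on x. Up to the normalization, J is
    the exponential moment of X at t + (t - mu) / l, which is finite as soon as
    l is so large that this number lies between 0 and lambda. This replaces the
    usual appeal to Young's inequality: no L^q norm is needed.

    Three facts carry the formal argument. A pointwise inequality between
    products passes to iterated convolutions ([convolutions_le_sum]). An
    iterated convolution with one factor constantly 1 is the constant product
    of the integrals of the other factors ([convolutions_cst1]); this rests on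
    the invariance of Lebesgue measure under u |-> x - u
    ([ge0_integral_row_subr]). Expectations of functions of X are integrals
    against its density ([ge0_expectation_density]). *)

(** * Measurability of the operations on row vectors *)

Section measurable_row_ops.
Context {R : realType}.

Lemma measurable_subr_row d (T : measurableType d) k (f g : T -> 'rV[R]_k) :
  measurable_fun setT f -> measurable_fun setT g ->
  measurable_fun setT (fun t => f t - g t).
Proof.
move=> /measurable_fun_rowP mf /measurable_fun_rowP mg.
apply/measurable_fun_rowP => i; under eq_fun do rewrite !mxE.
exact: measurable_funB.
Qed.

Lemma measurable_dotv k (e : 'rV[R]_k) : measurable_fun setT (dotv e).
Proof.
rewrite /dotv; apply: measurable_sum => i.
by apply: measurable_funM => //; exact: measurable_coor.
Qed.

End measurable_row_ops.

(** * Invariance of Lebesgue measure under point reflections *)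

Section reflection_invariance.
Context {R : realType}.
Local Open Scope ereal_scope.

(** Reflections send half-open intervals to half-open intervals of the same
    length, up to endpoints, and those determine the measure. *)
Lemma lebesgue_measure_subr (c : R) (A : set R) : measurable A ->
  pushforward lebesgue_measure
    ((fun r => c - r)%R : measurableTypeR R -> measurableTypeR R) A =
  lebesgue_measure (A : set (measurableTypeR R)).
Proof.
have mphi : measurable_fun setT
    ((fun r => c - r)%R : measurableTypeR R -> measurableTypeR R).
  exact: measurable_funB.
pose phi : {mfun measurableTypeR R >-> measurableTypeR R} :=
  HB.pack (fun r : measurableTypeR R => c - r : measurableTypeR R)%R
    (isMeasurableFun.Build _ _ _ _ _ mphi).
move=> mA; apply/esym.
apply: (@lebesgue_measure_unique R (pushforward lebesgue_measure phi)) => //.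
move=> _ [[a b]] _ <-.
transitivity (lebesgue_measure
    (`[c - b, c - a[%classic%R : set (measurableTypeR R))); last first.
  congr (lebesgue_measure _); apply/seteqP.
  by split=> r /=; rewrite !in_itv/=; lra.
rewrite !lebesgue_measure_itv/= !lte_fin ltrD2l ltrN2.
by case: ifPn => // _; rewrite -!EFinB; congr _%:E; ring.
Qed.

Lemma ge0_integral_lebesgue_subr (c : R) (f : R -> \bar R) :
  measurable_fun setT f -> (forall r, 0 <= f r) ->
  \int[lebesgue_measure]_r f (c - r)%R = \int[lebesgue_measure]_r f r.
Proof.
move=> mf f0.
have mphi : measurable_fun setT
    ((fun r => c - r)%R : measurableTypeR R -> measurableTypeR R).
  exact: measurable_funB.
transitivity (\int[pushforward lebesgue_measure
    ((fun r => c - r)%R : measurableTypeR R -> measurableTypeR R)]_r f r).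
  by rewrite ge0_integral_pushforward.
by apply: eq_measure_integral => A mA _; exact: lebesgue_measure_subr.
Qed.

Lemma ge0_integral_row_cons k (f : 'rV[R]_k.+1 -> \bar R) :
  measurable_fun setT f -> (forall x, 0 <= f x) ->
  \int[lebesgue_row k.+1]_x f x =
  \int[lebesgue_measure]_r \int[lebesgue_row k]_v f (row_cons (r, v)).
Proof.
move=> mf f0 /=; rewrite /lebesgue_row_step.
rewrite ge0_integral_pushforward//; last exact: measurable_row_cons.
apply: (@fubini_tonelli1 _ _ _ _ _ lebesgue_measure (lebesgue_row k)
  (f \o @row_cons R k)); last by move=> z; exact: f0.
exact: measurableT_comp mf (@measurable_row_cons R k).
Qed.

Lemma row_consB k (z1 z2 : R * 'rV[R]_k) :
  (row_cons z1 - row_cons z2 = row_cons (z1.1 - z2.1, z1.2 - z2.2))%R.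
Proof.
apply/rowP => i; rewrite !mxE; case: splitP => j _; by rewrite !mxE.
Qed.

(** By induction on the dimension, since a point reflection acts coordinate by
    coordinate. Translations are compositions of two such maps, so this single
    invariance is all that convolutions require. *)
Lemma ge0_integral_row_subr k (x : 'rV[R]_k) (f : 'rV[R]_k -> \bar R) :
  measurable_fun setT f -> (forall x, 0 <= f x) ->
  \int[lebesgue_row k]_u f (x - u)%R = \int[lebesgue_row k]_u f u.
Proof.
elim: k x f => [|k IHk] x f mf f0.
  by apply: eq_integral => u _; congr f; apply/rowP => -[].
have mfc : measurable_fun setT
    (f \o @row_cons R k : measurableTypeR R * 'rV[R]_k -> \bar R).
  exact: measurableT_comp mf (@measurable_row_cons R k).
have mfx : measurable_fun setT (fun u : 'rV[R]_k.+1 => f (x - u)%R).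
  exact: (measurableT_comp mf
    (measurable_subr_row (measurable_cst x) (@measurable_id _ _ setT))).
rewrite (ge0_integral_row_cons mf f0).
rewrite (ge0_integral_row_cons mfx (fun u => f0 (x - u)%R)).
pose F (r : measurableTypeR R) := \int[lebesgue_row k]_v f (row_cons (r, v)).
have mF : measurable_fun setT F.
  exact: (measurable_fun_fubini_tonelli_F _ mfc (fun z => f0 (row_cons z))).
have F0 r : 0 <= F r by exact: integral_ge0.
rewrite -[RHS](ge0_integral_lebesgue_subr (x ord0 ord0) mF F0).
apply: eq_integral => r _; rewrite /F.
rewrite -(IHk (row_uncons x).2 (fun v => f (row_cons ((_ - r)%R, v)))).
- by apply: eq_integral => v _; rewrite -{1}(row_unconsK x) row_consB.
- exact: (measurableT_comp mfc (measurable_pair1 _)).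
- by move=> v; exact: f0.
Qed.

End reflection_invariance.

(** * Integration against a measure given by a density *)

Section density_integral.
Context {R : realType}.
Local Open Scope ereal_scope.

(** The density agrees almost everywhere with the Radon-Nikodym derivative, for
    which the change of variables is known. *)
Lemma ge0_integral_density d (T : measurableType d)
    (mu : {sigma_finite_measure set T -> \bar R})
    (nu : {finite_measure set T -> \bar R}) (p h : T -> \bar R) :
  measurable_fun setT p -> (forall x, 0 <= p x) ->
  (forall A, measurable A -> nu A = \int[mu]_(x in A) p x) ->
  measurable_fun setT h -> (forall x, 0 <= h x) ->
  \int[nu]_x h x = \int[mu]_x (h x * p x).
Proof.
move=> mp p0 nup mh h0.
have numu : nu `<< mu.
  apply/null_content_dominatesP => A mA A0; rewrite nup//.
  by apply: null_set_integral => //; exact: measurable_funTS.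
rewrite -(Radon_Nikodym_SigmaFinite.change_of_variables numu)//.
have fint := Radon_Nikodym_SigmaFinite.f_integrable numu.
have mRN := measurable_int _ fint.
apply: ge0_ae_eq_integral => //.
- exact: emeasurable_funM.
- exact: emeasurable_funM.
- by move=> x _; rewrite mule_ge0// Radon_Nikodym_SigmaFinite.f_ge0.
- by move=> x _; rewrite mule_ge0.
apply: ae_eqe_mul2l; apply: integral_ae_eq => // E _ mE.
by rewrite -nup// (Radon_Nikodym_SigmaFinite.f_integral numu).
Qed.

End density_integral.

(** * Iterated convolutions *)

Section convolution_theory.
Context {R : realType} {k : nat}.
Local Open Scope ereal_scope.
Implicit Types (f g : 'rV[R]_k -> \bar R) (F : nat -> 'rV[R]_k -> \bar R).

Lemma measurable_convolution_integrand f g :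
  measurable_fun setT f -> measurable_fun setT g ->
  measurable_fun setT
    (fun z : 'rV[R]_k * 'rV[R]_k => f (z.1 - z.2)%R * g z.2).
Proof.
move=> mf mg; apply: emeasurable_funM.
  by apply: (measurableT_comp mf); exact: measurable_subr_row.
exact: (measurableT_comp mg).
Qed.

Lemma convolution_ge0 f g : (forall x, 0 <= f x) -> (forall x, 0 <= g x) ->
  forall x, 0 <= convolution f g x.
Proof. by move=> f0 g0 x; apply: integral_ge0 => u _; exact: mule_ge0. Qed.

Lemma measurable_convolution f g :
  measurable_fun setT f -> measurable_fun setT g ->
  (forall x, 0 <= f x) -> (forall x, 0 <= g x) ->
  measurable_fun setT (convolution f g).
Proof.
move=> mf mg f0 g0.
apply: (measurable_fun_fubini_tonelli_F _
  (measurable_convolution_integrand mf mg)) => z.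
exact: mule_ge0.
Qed.

Lemma measurable_convolution_section f g (x : 'rV[R]_k) :
  measurable_fun setT f -> measurable_fun setT g ->
  measurable_fun setT (fun u : 'rV[R]_k => f (x - u)%R * g u).
Proof.
move=> mf mg.
exact: (measurableT_comp (measurable_convolution_integrand mf mg)
  (measurable_pair1 x)).
Qed.

Lemma convolution_cst f (c : \bar R) : measurable_fun setT f ->
  (forall x, 0 <= f x) -> 0 <= c ->
  forall x, convolution f (cst c) x = \int[lebesgue_row k]_u f u * c.
Proof.
move=> mf f0 c0 x; rewrite -(ge0_integral_row_subr x mf f0).
rewrite /convolution ge0_integralZr//.
exact: (measurableT_comp mf
  (measurable_subr_row (measurable_cst x) (@measurable_id _ _ setT))).
Qed.

(** Tonelli; the inner integral of f (x - u) over x is that of f because the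
    translation x |-> x - u is the composition of the reflections x |-> - x and
    x |-> - u - x. *)
Lemma integral_convolution f g :
  measurable_fun setT f -> measurable_fun setT g ->
  (forall x, 0 <= f x) -> (forall x, 0 <= g x) ->
  \int[lebesgue_row k]_x convolution f g x =
  \int[lebesgue_row k]_x f x * \int[lebesgue_row k]_x g x.
Proof.
move=> mf mg f0 g0.
rewrite (fubini_tonelli _ (measurable_convolution_integrand mf mg))/=;
  last by move=> z; exact: mule_ge0.
have msub (u : 'rV[R]_k) : measurable_fun setT (fun x : 'rV[R]_k => (x - u)%R).
  exact: (measurable_subr_row (@measurable_id _ _ setT) (measurable_cst u)).
have E u : \int[lebesgue_row k]_x (f (x - u)%R * g u) =
    \int[lebesgue_row k]_x f x * g u.
  rewrite ge0_integralZr//; last exact: (measurableT_comp mf (msub u)).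
  congr (_ * _).
  rewrite -(ge0_integral_row_subr 0%R (measurableT_comp mf (msub u)));
    last by move=> x; exact: f0.
  rewrite -(ge0_integral_row_subr (- u)%R mf f0).
  by apply: eq_integral => x _ /=; congr f; rewrite sub0r addrC.
under eq_integral do rewrite E.
by rewrite ge0_integralZl//; exact: integral_ge0.
Qed.

(** A family of factors rather than a single function, because the comparison
    below replaces one factor by the constant 1. *)
Fixpoint convolutions F l : 'rV[R]_k -> \bar R :=
  if l is l'.+1 then convolution (F l) (convolutions F l') else F 0%N.

Lemma convolution_iterE f l :
  convolution_iter f l.+1 = convolutions (fun=> f) l.
Proof.
by rewrite /convolution_iter iteropS; elim: l => //= l ->.
Qed.

Section family.
Variable F : nat -> 'rV[R]_k -> \bar R.
Hypothesis mF : forall j, measurable_fun setT (F j).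
Hypothesis F0 : forall j x, 0 <= F j x.

Lemma convolutions_ge0 l x : 0 <= convolutions F l x.
Proof. by elim: l x => //= l IHl x; exact: convolution_ge0. Qed.

Lemma measurable_convolutions l : measurable_fun setT (convolutions F l).
Proof.
elim: l => //= l IHl; apply: measurable_convolution => // x.
exact: convolutions_ge0.
Qed.

Lemma integral_convolutions l :
  \int[lebesgue_row k]_x convolutions F l x =
  \prod_(j < l.+1) \int[lebesgue_row k]_x F j x.
Proof.
elim: l => [|l IHl]; first by rewrite big_ord_recl big_ord0 mule1.
rewrite big_ord_recr [RHS]muleC -IHl.
exact: (integral_convolution (mF l.+1) (measurable_convolutions l)
  (F0 l.+1) (@convolutions_ge0 l)).
Qed.

(** The factor 1 turns the convolution of the factors below i into its integral,
    hence into a constant, and convolving a constant with a factor above i only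
    multiplies it by the integral of that factor. *)
Lemma convolutions_cst1 i l x : F i = cst 1 -> (i <= l)%N ->
  convolutions F l x =
  \prod_(j < l.+1 | (j : nat) != i) \int[lebesgue_row k]_u F j u.
Proof.
move=> Fi; elim: l x => [|l IHl] x.
  rewrite leqn0 => /eqP i0; rewrite i0 in Fi *.
  by rewrite big_mkcond big_ord_recl big_ord0 /= Fi mule1.
rewrite big_mkcond big_ord_recr /= leq_eqVlt => /predU1P[il|].
  rewrite {}il in Fi *; rewrite eqxx mule1 /convolution Fi.
  under eq_integral do rewrite mul1e.
  rewrite integral_convolutions.
  by apply: eq_bigr => j _; rewrite ltn_eqF.
rewrite ltnS -big_mkcond => il; rewrite gtn_eqF//= muleC.
rewrite (_ : convolutions F l = cst (\prod_(j < l.+1 | (j : nat) != i)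
    \int[lebesgue_row k]_u F j u)); last by apply/funext => y; exact: IHl.
rewrite convolution_cst//; apply: prode_ge0 => j _; exact: integral_ge0.
Qed.

End family.

(** The weights c and b are there for the induction: once the outermost variable
    u is fixed, the factors F l.+1 (x - u) and G i l.+1 (x - u) are absorbed in
    them, and the comparison of the remaining factors is integrated over u. *)
Lemma convolutions_le_sum (I : finType) F (G : I -> nat -> 'rV[R]_k -> \bar R)
    (c : \bar R) (b : I -> \bar R) l x :
  (forall j, measurable_fun setT (F j)) -> (forall j x, 0 <= F j x) ->
  (forall i j, measurable_fun setT (G i j)) -> (forall i j x, 0 <= G i j x) ->
  0 <= c -> (forall i, 0 <= b i) ->
  (forall u : nat -> 'rV[R]_k, c * \prod_(j < l.+1) F j (u j) <=
    \sum_i b i * \prod_(j < l.+1) G i j (u j)) ->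
  c * convolutions F l x <= \sum_i b i * convolutions (G i) l x.
Proof.
move=> mF F0 mG G0; elim: l c b x => [|l IHl] c b x c0 b0 FG.
  have := FG (fun=> x); rewrite big_ord_recl big_ord0 mule1.
  by under eq_bigr do rewrite big_ord_recl big_ord0 mule1.
rewrite /= /convolution -ge0_integralZl//; last 2 first.
- apply: measurable_convolution_section => //.
  exact: measurable_convolutions.
- by move=> u _; apply: mule_ge0 => //; exact: convolutions_ge0.
have mGi i : measurable_fun setT
    (fun u : 'rV[R]_k => G i l.+1 (x - u)%R * convolutions (G i) l u).
  apply: measurable_convolution_section => //.
  exact: measurable_convolutions.
have Gi0 i u : 0 <= G i l.+1 (x - u)%R * convolutions (G i) l u.
  by apply: mule_ge0 => //; exact: convolutions_ge0.
under [leRHS]eq_bigr do rewrite -ge0_integralZl//.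
rewrite -ge0_integral_sum//; last 2 first.
- by move=> i; exact: measurable_funeM.
- by move=> i u _; exact: mule_ge0.
apply: ge0_le_integral => //.
- by move=> u _; rewrite !mule_ge0//; exact: convolutions_ge0.
- apply: measurable_funeM; apply: measurable_convolution_section => //.
  exact: measurable_convolutions.
- by apply: emeasurable_sum => i; exact: measurable_funeM.
move=> u _; rewrite muleA.
under eq_bigr do rewrite muleA.
apply: IHl => [|i|v]; [exact: mule_ge0|exact: mule_ge0|].
(* The point x - u occupies the outermost position, v the others. *)
pose w j := if j == l.+1 then (x - u)%R else v j.
have prodw (H : nat -> 'rV[R]_k -> \bar R) : \prod_(j < l.+2) H j (w j) =
    H l.+1 (x - u)%R * \prod_(j < l.+1) H j (v j).
  rewrite big_ord_recr muleC /w /= eqxx; congr (_ * _).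
  by apply: eq_bigr => j _; rewrite ltn_eqF.
rewrite -muleA -prodw; under [leRHS]eq_bigr do rewrite -muleA -prodw.
exact: FG.
Qed.

End convolution_theory.

(** * Bounded convolution powers *)

(** The growth bound is spent on the single factor at which y is smallest: its n
    exponentials are distributed over the n other factors. The sum over i
    stands for the unknown position of that factor. *)
Lemma prod_le_sum_omit_one (R : realType) n (a y : 'I_n.+1 -> R) (C : R) :
  (forall j, 0 <= a j) -> (forall j, a j <= C * expR (n%:R * y j)) ->
  \prod_j a j <= \sum_i C * \prod_(j | j != i) (a j * expR (y j)).
Proof.
move=> a0 aC.
have C0 : 0 <= C.
  by rewrite -(pmulr_lge0 _ (expR_gt0 (n%:R * y ord0))) (le_trans (a0 ord0)).
case: (@arg_minP _ _ _ ord0 xpredT y isT) => i _ ymin.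
rewrite (bigD1 i)//= [leRHS](bigD1 i)//=; apply: ler_wpDr.
  by apply: sumr_ge0 => j _; rewrite mulr_ge0// prodr_ge0// => m _;
    rewrite mulr_ge0// expR_ge0.
rewrite big_split/= mulrCA [leRHS]mulrC ler_wpM2r ?prodr_ge0//.
apply: le_trans (aC i) _; rewrite ler_wpM2l// expRM_natl.
have -> : expR (y i) ^+ n = \prod_(j | j != i) expR (y i).
  by rewrite prodr_const (cardC1 i) card_ord.
by apply: ler_prod => j _; rewrite expR_ge0 ler_expR ymin.
Qed.

(** A substitute for Young's inequality: a bound on f against the l-th power of
    the weight expR y, and integrability against the weight itself, suffice for
    l + 1 factors. *)
Lemma ebounded_convolution_iter (R : realType) k (f y : 'rV[R]_k -> R) (C : R)
    (l : nat) :
  measurable_fun setT f -> measurable_fun setT y ->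
  (forall x, 0 <= f x) -> (forall x, f x <= C * expR (l%:R * y x)) ->
  (\int[lebesgue_row k]_x (f x * expR (y x))%:E < +oo)%E ->
  ebounded (convolution_iter (fun x => (f x)%:E) l.+1).
Proof.
move=> mf my f0 fC J_fin.
have C0 : 0 <= C.
  by rewrite -(pmulr_lge0 _ (expR_gt0 (l%:R * y 0))) (le_trans (f0 0)).
pose g x := (f x * expR (y x))%:E.
have mg : measurable_fun setT g.
  by apply/measurable_EFinP; apply: measurable_funM => //;
    exact: measurableT_comp.
have g0 x : (0 <= g x)%E by rewrite lee_fin mulr_ge0// expR_ge0.
pose J := fine (\int[lebesgue_row k]_x g x).
have JE : (\int[lebesgue_row k]_x g x = J%:E)%E.
  by rewrite fineK// ge0_fin_numE// integral_ge0.
(* The i-th alternative family: the i-th factor is dropped. *)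
pose G (i : 'I_l.+1) (j : nat) : 'rV[R]_k -> \bar R :=
  if j == i then cst 1%E else g.
have mG i j : measurable_fun setT (G i j) by rewrite /G; case: ifP.
have G0 i j x : (0 <= G i j x)%E.
  by rewrite /G; case: ifP => //= _; rewrite lee_fin.
have mfE : measurable_fun setT (fun x => (f x)%:E) by exact/measurable_EFinP.
exists (\sum_(i < l.+1) C * \prod_(j < l.+1 | j != i) J) => x.
rewrite convolution_iterE gee0_abs; last first.
  by apply: convolutions_ge0 => j z; rewrite lee_fin.
rewrite -[leLHS]mul1e.
apply: le_trans (@convolutions_le_sum R k 'I_l.+1 (fun _ x => (f x)%:E)
  G 1%E (fun=> C%:E) l x _ _ mG G0 _ _ _) _ => //.
- move=> u; rewrite mul1e prodEFin.
  apply: (@le_trans _ _ (\sum_(i < l.+1) C *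
      \prod_(j < l.+1 | j != i) (f (u j) * expR (y (u j))))%:E).
    by rewrite lee_fin; exact: prod_le_sum_omit_one.
  rewrite -sumEFin; apply: lee_sum => i _; rewrite EFinM lee_wpmul2l ?lee_fin//.
  rewrite -prodEFin big_mkcond/= le_eqVlt; apply/orP; left; apply/eqP.
  by apply: eq_bigr => j _; rewrite /G -val_eqE/=; case: eqP.
- rewrite -sumEFin; apply: lee_sum => i _; rewrite EFinM lee_wpmul2l ?lee_fin//.
  rewrite (convolutions_cst1 (mG i) (G0 i) (i := i))//; last 2 first.
    by rewrite /G eqxx.
    by rewrite -ltnS.
  rewrite -prodEFin le_eqVlt; apply/orP; left; apply/eqP.
  by apply: eq_bigr => j ji; rewrite -JE /G ifN.
Qed.

(** * Exponential moments *)

Section exponential_moments.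
Context {R : realType} {k : nat}.
Context d (T : measurableType d) (P : probability T R).
Variables (X : {RV P >-> 'rV[R]_k}) (p : 'rV[R]_k -> R).
Local Open Scope ereal_scope.

Lemma ge0_expectation_density (h : 'rV[R]_k -> R) :
  is_density X p -> measurable_fun setT h -> (forall x, (0 <= h x)%R) ->
  'E_P[fun w => h (X w)] = \int[lebesgue_row k]_x (h x * p x)%:E.
Proof.
move=> [mp p0 pX] mh h0; rewrite unlock.
transitivity (\int[distribution P X]_x (h x)%:E).
  rewrite ge0_integral_pushforward//; first exact/measurable_EFinP.
  by move=> x _; rewrite lee_fin.
rewrite (@ge0_integral_density _ _ _ (lebesgue_row k) _ (EFin \o p))//;
  exact/measurable_EFinP.
Qed.

(** expR (a * s) is at most 1 for s < 0 and at most expR (lambda * s) for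
    s >= 0. *)
Lemma exponential_moment_lty (e : 'rV[R]_k) (lambda a : R) :
  (0 <= a <= lambda)%R ->
  'E_P[fun w => expR (lambda * dotv e (X w))] < +oo ->
  'E_P[fun w => expR (a * dotv e (X w))] < +oo.
Proof.
move=> /andP[a0 al]; rewrite unlock => Hfin.
have mexp b : measurable_fun setT (fun w => (expR (b * dotv e (X w)))%:E).
  apply/measurable_EFinP; apply: measurableT_comp => //.
  apply: measurable_funM => //.
  exact: (measurableT_comp (measurable_dotv e)).
apply: (@le_lt_trans _ _ (\int[P]_w (1 + (expR (lambda * dotv e (X w)))%:E))).
  apply: ge0_le_integral => //.
  - exact: emeasurable_funD.
  move=> w _; rewrite -EFinD lee_fin; set s := dotv e (X w).
  have [s0|s0] := leP 0%R s.
    rewrite (@le_trans _ _ (expR (lambda * s)))//; last by rewrite lerDr.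
    by rewrite ler_expR ler_wpM2r.
  rewrite (@le_trans _ _ 1%R)//; last by rewrite lerDl expR_ge0.
  by rewrite -expR0 ler_expR mulr_ge0_le0// ltW.
rewrite ge0_integralD// integral_cst//= mul1e probability_setT.
by rewrite lte_add_pinfty// ltry.
Qed.

End exponential_moments.

(** * Tilted densities *)

Theorem corollary2p4 (R : realType) (k : nat) (hk : (1 <= k)%N)
    (e : 'rV[R]_k) (he : normv2 e = 1)
    (lambda : R) (hlambda : 0 < lambda)
    (d : measure_display) (T : measurableType d) (P : probability T R)
    (X : {RV P >-> 'rV[R]_k}) (p : 'rV[R]_k -> R) (hp : is_density X p)
    (hmgf : ('E_P[fun w => expR (lambda * dotv e (X w))] < +oo)%E)
    (hbound : exists mu : R, exists C : R,
      [/\ 0 <= mu < lambda, 0 < C &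
          forall x : 'rV[R]_k, p x <= C * expR (- mu * dotv e x)]) :
  forall t : R, 0 < t < lambda ->
    exists nt : nat, (1 <= nt)%N /\
      forall n : nat, (nt <= n)%N ->
        ebounded (convolution_iter (fun x => (tilted_density X e t p x)%:E) n).
Proof.
move=> t /andP[t0 tl]; case: hbound => mu [C [_ C0 pC]].
have [mp p0 _] := hp.
(* If `|s| <= m, then t + s lies between 0 and lambda. *)
pose m := Num.min t (lambda - t).
have m0 : 0 < m by rewrite lt_min t0 subr_gt0.
pose N := Num.bound (`|t - mu| / m).
have NP : `|t - mu| / m < N%:R by apply: archi_boundP; rewrite divr_ge0// ltW.
(* n = l + 1 with l > N, so that dividing t - mu by l brings it below m. *)
exists N.+2; split=> // -[//|l]; rewrite ltnS => Nl.
have l0 : 0 < l%:R :> R by rewrite ltr0n (leq_trans _ Nl).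
pose s := (t - mu) / l%:R.
have sm : `|s| <= m.
  rewrite normrM normfV (gtr0_norm l0) ler_pdivrMr// mulrC -ler_pdivrMr//.
  by rewrite (le_trans (ltW NP))// ler_nat ltnW// ltnW.
have ts : 0 <= t + s <= lambda.
  by move: sm; rewrite /m le_min !ler_norml; lra.
pose c := (fine 'E_P[fun w => expR (t * dotv e (X w))])^-1.
have c0 : 0 <= c.
  by rewrite invr_ge0 fine_ge0// expectation_ge0// => w; exact: expR_ge0.
have mexp b : measurable_fun setT (fun x : 'rV[R]_k => expR (b * dotv e x)).
  apply: measurableT_comp => //; apply: measurable_funM => //.
  exact: measurable_dotv.
apply: (@ebounded_convolution_iter _ _ _ (fun x => s * dotv e x) (c * C)).
- by apply: measurable_funM => //; exact: measurable_funM.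
- by apply: measurable_funM => //; exact: measurable_dotv.
- by move=> x; rewrite !mulr_ge0// expR_ge0.
- move=> x; rewrite /tilted_density -/c mulrC -mulrA ler_wpM2l//.
  apply: (@le_trans _ _ (expR (t * dotv e x) * (C * expR (- mu * dotv e x)))).
    by rewrite ler_wpM2l ?expR_ge0.
  rewrite mulrCA -expRD (ler_wpM2l (ltW C0))// ler_expR mulrA /s.
  by rewrite [_ * (_ / _)]mulrC divfK ?gt_eqF// mulrBl mulNr.
under eq_integral => x _.
  have -> : (tilted_density X e t p x * expR (s * dotv e x))%:E =
      (c%:E * (expR ((t + s) * dotv e x) * p x)%:E)%E.
    rewrite /tilted_density -/c -EFinM mulrDl expRD; congr _%:E; ring.
  over.
rewrite ge0_integralZl_EFin//.
- rewrite -(ge0_expectation_density hp (mexp _))//.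
  by rewrite lte_mul_pinfty//; exact: exponential_moment_lty hmgf.
- by move=> x _; rewrite lee_fin mulr_ge0// expR_ge0.
- by apply/measurable_EFinP; exact: measurable_funM.
Qed.
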